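(* Let $\Omega\subseteq\mathbb{R}^n$ be open and let $u=(u_\varepsilon)\in\mathcal{P}^{\mathrm{e}}(\Omega)=\prod_{\varepsilon\in I^{\mathrm{e}}}\mathcal{C}^\infty(\Omega_\varepsilon,\mathbb{R})$. Then: (i) $u^\vee\in\mathcal{E}_M^{\mathrm{e}}(\Omega)$ if and only if $\forall K\Subset\Omega\ \forall\alpha\in\mathbb{N}^n\ \exists N\in\mathbb{N}:\ \sup_{x\in K}|\partial^\alpha u_\varepsilon(x)|=O(\underline{\varepsilon}^{-N})$ as $\varepsilon\in\mathbb{I}^{\mathrm{e}}$; (ii) $u^\vee\in\mathcal{N}^{\mathrm{e}}(\Omega)$ if and only if $\forall K\Subset\Omega\ \forall\alpha\in\mathbb{N}^n\ \forall m\in\mathbb{N}:\ \sup_{x\in K}|\partial^\alpha u_\varepsilon(x)|=O(\underline{\varepsilon}^{m})$ as $\varepsilon\in\mathbb{I}^{\mathrm{e}}$.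
   Context: $\mathbb{N}=\{0,1,2,\dots\}$, $n\ge1$; $K\Subset\Omega$ means $K$ is a compact subset of $\Omega$. $\mathcal{D}(\mathbb{R}^n)$ is the space of (real-valued) test functions. For $\varphi\in\mathcal{D}(\mathbb{R}^n)$ and $r>0$, $(r\odot\varphi)(y):=r^{-n}\varphi(y/r)$. For $\varphi\neq0$, $\underline{\varphi}:=\mathrm{diam}(\mathrm{supp}(\varphi))$. Index structure: $\mathcal{A}_0:=\{\varphi\in\mathcal{D}(\mathbb{R}^n)\mid\int\varphi=1\}$; for $q\in\mathbb{N}$, $\mathcal{A}_q:=\{\varphi\in\mathcal{A}_0\mid\int x^\alpha\varphi(x)\,dx=0\ \forall\alpha\in\mathbb{N}^n,\ 1\le|\alpha|\le q\}$. $\mathbb{I}^{\mathrm{e}}=(I^{\mathrm{e}},\le,\mathcal{I}^{\mathrm{e}})$ with $I^{\mathrm{e}}:=\mathcal{A}_0$, $\mathcal{I}^{\mathrm{e}}:=\{\mathcal{A}_q\mid q\in\mathbb{N}\}$, and $\varepsilon\le e$ iff there is $r\in(0,1]$ with $\varepsilon=r\odot e$. Put $(\emptyset,e]:=\{\varepsilon\in I^{\mathrm{e}}\mid\varepsilon\le e\}$ and $A_{\le e}:=(\emptyset,e]\cap A$. Big-O: for real nets indexed by $I^{\mathrm{e}}$, $x_\varepsilon=O(y_\varepsilon)$ as $\varepsilon\in\mathbb{I}^{\mathrm{e}}$ means: there is $A\in\mathcal{I}^{\mathrm{e}}$ such that for all $a\in A$ there are $H>0$ and $\varepsilon_0\in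 A_{\le a}$ with $|x_\varepsilon|\le H|y_\varepsilon|$ for all $\varepsilon\in A_{\le\varepsilon_0}$. Full algebra: $U(\Omega):=\{(\varphi,x)\in\mathcal{A}_0\times\Omega\mid\mathrm{supp}(\varphi)\subseteq\Omega-x\}$ and, for $\varphi\in\mathcal{A}_0$, $\Omega_\varphi:=\{x\in\Omega\mid\mathrm{supp}(\varphi)\subseteq\Omega-x\}$. $\mathcal{E}^{\mathrm{e}}(\Omega)$ is the set of all $R:U(\Omega)\to\mathbb{R}$ such that $R(\varphi,-)$ is smooth on $\Omega_\varphi$ for all $\varphi\in\mathcal{A}_0$. $R\in\mathcal{E}^{\mathrm{e}}_M(\Omega)$ iff $R\in\mathcal{E}^{\mathrm{e}}(\Omega)$ and $\forall K\Subset\Omega\,\forall\alpha\in\mathbb{N}^n\,\exists N\in\mathbb{N}\,\forall\varphi\in\mathcal{A}_N$: $\sup_{x\in K}|\partial^\alpha R(r\odot\varphi,x)|=O(r^{-N})$ as $r\to0^+$. $R\in\mathcal{N}^{\mathrm{e}}(\Omega)$ iff $R\in\mathcal{E}^{\mathrm{e}}(\Omega)$ and $\forall K\Subset\Omega\,\forall\alpha\in\mathbb{N}^n\,\forall m\in\mathbb{N}\,\exists q\in\mathbb{N}\,\forall\varphi\in\mathcal{A}_q$: $\sup_{x\in K}|\partial^\alpha R(r\odot\varphi,x)|=O(r^{m})$ as $r\to0^+$. Here $\partial^\alpha$ acts on the variable $x$. For $u\in\mathcal{P}^{\mathrm{e}}(\Omega)$, $u^\vee:U(\Omega)\to\mathbb{R}$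 is $u^\vee(\varphi,x):=u_\varphi(x)$. Convention: the supremum over $K$ is meaningful when $K\subseteq\Omega_\varepsilon$; for fixed $\varphi$ and $K$ this holds for $\varepsilon=r\odot\varphi$ with $r$ sufficiently small, and the (arbitrary) value assigned to the supremum when $K\not\subseteq\Omega_\varepsilon$ (say $0$) is irrelevant. *)

(* Defs.v *)
From HB Require Import structures.
From mathcomp Require Import all_boot all_order all_algebra.
From mathcomp Require Import all_classical all_reals all_analysis.

Set Implicit Arguments.
Unset Strict Implicit.
Unset Printing Implicit Defensive.

Import Order.TTheory GRing.Theory Num.Theory.
Import numFieldNormedType.Exports.

Local Open Scope classical_set_scope.
Local Open Scope ring_scope.

(* n-dimensional Lebesgue measure: the n-fold product of [lebesgue_measure],
   carried by [n.-tuple R] with its product Borel sigma-algebra; each factor is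
   added by transporting [lebesgue_measure \x mu] along [tuple_cons].
   [lebesgue_tuple_box] checks the value on measurable boxes. *)

Definition tuple_cons (R : realType) (n : nat)
    (p : measurableTypeR R * n.-tuple (measurableTypeR R)) :
  n.+1.-tuple (measurableTypeR R) := [the n.+1.-tuple _ of p.1 :: p.2].

Definition tuple_behead (R : realType) (n : nat)
    (t : n.+1.-tuple (measurableTypeR R)) :
  n.-tuple (measurableTypeR R) := [tuple of behead t].

Lemma measurable_tuple_cons (R : realType) (n : nat) :
  measurable_fun setT (@tuple_cons R n).
Proof.
by apply: measurable_cons; [exact: measurable_fst|exact: measurable_snd].
Qed.

Section lebesgue_cons.
Context (R : realType) (n : nat).
Variable mu : {sigma_finite_measure set (n.-tuple (measurableTypeR R)) -> \bar R}.
Local Notation leb1 := (@lebesgue_measure R).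

Definition lebesgue_cons : set (n.+1.-tuple (measurableTypeR R)) -> \bar R :=
  pushforward (leb1 \x mu)%E (@tuple_cons R n).

Let lebesgue_cons0 : lebesgue_cons set0 = 0%E.
Proof. by rewrite /lebesgue_cons /pushforward preimage_set0 measure0. Qed.

Let lebesgue_cons_ge0 A : (0 <= lebesgue_cons A)%E.
Proof.
by rewrite /lebesgue_cons /pushforward; apply: integral_ge0 => x _;
  exact: measure_ge0.
Qed.

Let lebesgue_cons_additive : semi_sigma_additive lebesgue_cons.
Proof.
move=> F mF tF mUF; rewrite /lebesgue_cons /pushforward preimage_bigcup.
have mc := @measurable_tuple_cons R n.
apply: (@measure_semi_sigma_additive _ _ _ (leb1 \x mu)%E).
- by move=> k; rewrite -[X in measurable X]setTI; exact: mc.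
- apply/trivIsetP => /= i j _ _ ij; rewrite -preimage_setI.
  by move/trivIsetP : tF => /(_ _ _ _ _ ij) ->//; rewrite preimage_set0.
- by rewrite -preimage_bigcup -[X in measurable X]setTI; exact: mc.
Qed.

HB.instance Definition _ := isMeasure.Build _ _ _ lebesgue_cons
  lebesgue_cons0 lebesgue_cons_ge0 lebesgue_cons_additive.

Lemma lebesgue_consX A B : measurable A -> measurable B ->
  lebesgue_cons ((fun t => tnth t ord0) @^-1` A `&` @tuple_behead R n @^-1` B)
  = (leb1 A * mu B)%E.
Proof.
move=> mA mB; rewrite -product_measure1E//; congr product_measure1.
apply/seteqP; split=> -[x t] /=.
  move=> [Ax]; rewrite (_ : tuple_behead _ = t) => [Bt|].
    by split=> //; move: Ax; rewrite (tnth_nth x).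
  exact/val_inj.
move=> [Ax Bt]; split; first by rewrite (tnth_nth x).
by rewrite /preimage/= (_ : tuple_behead _ = t)//; exact/val_inj.
Qed.

Let lebesgue_cons_sigma_finite : sigma_finite setT lebesgue_cons.
Proof.
have /sigma_finiteP[F [TF ndF Foo]] := sigma_finiteT leb1.
have /sigma_finiteP[G [TG ndG Goo]] := sigma_finiteT mu.
exists (fun k => (fun t => tnth t ord0) @^-1` F k `&` @tuple_behead R n @^-1` G k).
  apply/seteqP; split=> // t _.
  have : setT (tnth t ord0) by [].
  rewrite TF => -[i _ Fi].
  have : setT (tuple_behead t) by [].
  rewrite TG => -[j _ Gj].
  exists (maxn i j) => //; split.
    by have /subsetPset sF := ndF _ _ (leq_maxl i j); exact: sF.
  by have /subsetPset sG := ndG _ _ (leq_maxr i j); exact: sG.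
move=> k; have [mF Fk] := Foo k; have [mG Gk] := Goo k; split; last first.
  by rewrite lebesgue_consX// lte_mul_pinfty// ge0_fin_numE.
apply: measurableI; rewrite -[X in measurable X]setTI.
  exact: measurable_tnth.
exact: measurable_behead.
Qed.

HB.instance Definition _ := Measure_isSigmaFinite.Build _ _ _ lebesgue_cons
  lebesgue_cons_sigma_finite.

End lebesgue_cons.

Fixpoint lebesgue_tuple (R : realType) (n : nat) :
    {sigma_finite_measure set (n.-tuple (measurableTypeR R)) -> \bar R} :=
  if n is k.+1 then lebesgue_cons (lebesgue_tuple R k)
  else \d_([tuple] : 0.-tuple (measurableTypeR R)).

Lemma lebesgue_tuple_box (R : realType) (n : nat)
    (A : 'I_n -> set (measurableTypeR R)) :
  (forall i, measurable (A i)) ->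
  measurable [set t | forall i, A i (tnth t i)] /\
  lebesgue_tuple R n [set t | forall i, A i (tnth t i)] =
  (\prod_(i < n) @lebesgue_measure R (A i))%E.
Proof.
elim: n => [|n IHn] in A *.
  move=> _; rewrite big_ord0 (_ : [set t | _] = setT); last first.
    by apply/seteqP; split=> // t _ [].
  by split=> //=; rewrite diracT.
move=> mA; have [mB IH] := IHn (A \o lift ord0) (fun i => mA _).
have -> : [set t : n.+1.-tuple (measurableTypeR R) | forall i, A i (tnth t i)] =
    (fun t => tnth t ord0) @^-1` A ord0 `&`
    @tuple_behead R n @^-1` [set t | forall i, (A \o lift ord0) i (tnth t i)].
  apply/seteqP; split=> t /=.
    move=> At; split=> [|i]; first exact: At.
    by rewrite /tuple_behead tnth_behead -(lift0 i) inord_val; exact: At.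
  move=> [A0 AS] i; case: (unliftP ord0 i) => [j ->|->//].
  by move: (AS j); rewrite /tuple_behead tnth_behead -(lift0 j) inord_val.
split; last by rewrite big_ord_recl -IH; exact: lebesgue_consX.
apply: measurableI; rewrite -[X in measurable X]setTI.
  exact: measurable_tnth.
exact: measurable_behead.
Qed.

Section calculus.
Context (R : realType) (n : nat).
Local Notation Rn := 'rV[R]_n.

Definition intRn (f : Rn -> R) : R :=
  Rintegral (lebesgue_tuple R n) setT (fun t => f (\row_i tnth t i)).

Definition multi_index := {ffun 'I_n -> nat}.

Definition morder (a : multi_index) : nat := (\sum_i a i)%N.

Definition monomial (a : multi_index) (x : Rn) : R := \prod_i x 0 i ^+ a i.

Definition partial (i : 'I_n) (f : Rn -> R) : Rn -> R := 'D_(delta_mx 0 i) f.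

Definition partials (s : seq 'I_n) (f : Rn -> R) : Rn -> R := foldr partial f s.

(* The list of directions is 0, ..., 0, 1, ..., 1, ..., each i occurring a i
   times. *)
Definition mpartial (a : multi_index) (f : Rn -> R) : Rn -> R :=
  partials (flatten [seq nseq (a i) i | i <- enum 'I_n]) f.

(* f is C^oo on the open set U: all its iterated partial derivatives, in any
   order of differentiation, exist and are continuous at every point of U.
   A function on U is represented by a total function; only its values on U
   matter, as U is open. *)
Definition smooth_on (U : set Rn) (f : Rn -> R) : Prop :=
  forall (s : seq 'I_n) (x : Rn), U x ->
    {for x, continuous (partials s f)} /\
    forall i : 'I_n, derivable (partials s f) x (delta_mx 0 i).

Definition supp (f : Rn -> R) : set Rn := closure [set x | f x != 0].

Definition test_function (f : Rn -> R) : Prop :=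
  smooth_on setT f /\ compact (supp f).

(* The library norm on row vectors is the sup norm, hence the explicit
   Euclidean norm. *)
Definition enorm (x : Rn) : R := Num.sqrt (\sum_i x 0 i ^+ 2).

Definition diam (A : set Rn) : R :=
  sup [set enorm (p.1 - p.2) | p in A `*` A].

Definition dil (r : R) (f : Rn -> R) : Rn -> R :=
  fun y => r ^- n * f (r^-1 *: y).

End calculus.

Section index_structure.
Context (R : realType) (n : nat).
Local Notation Rn := 'rV[R]_n.
Implicit Types (A : set (Rn -> R)) (phi eps e : Rn -> R).

Definition A_ (q : nat) : set (Rn -> R) :=
  [set phi | [/\ test_function phi, intRn phi = 1 &
     forall a : multi_index n, (1 <= morder a <= q)%N ->
       intRn (fun x => monomial a x * phi x) = 0]].

Definition Ie : set (Rn -> R) := A_ 0.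

Definition calIe : set (set (Rn -> R)) := range A_.

Definition leIe eps e : Prop :=
  exists2 r : R, 0 < r <= 1 & eps = dil r e.

(* The principal down-set of e, and its trace on A. *)
Definition downIe e : set (Rn -> R) := [set eps | Ie eps /\ leIe eps e].

Definition downIe_in A e : set (Rn -> R) := downIe e `&` A.

(* Real nets indexed by Ie; their values outside Ie play no role. *)
Definition bigO_Ie (x y : (Rn -> R) -> R) : Prop :=
  exists2 A, calIe A & forall a, A a ->
    exists H : R, exists eps0 : Rn -> R,
      [/\ 0 < H, downIe_in A a eps0 &
        forall eps, downIe_in A eps0 eps -> `|x eps| <= H * `|y eps|].

Definition size_supp phi : R := diam (supp phi).

End index_structure.

Section full_algebra.
Context (R : realType) (n : nat).
Local Notation Rn := 'rV[R]_n.
Local Notation at0 := (0^'+).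
Implicit Types (Omega K : set Rn) (phi eps : Rn -> R).

Definition Omega_ Omega phi : set Rn :=
  [set x | Omega x /\ supp phi `<=` [set y - x | y in Omega]].

(* sup over K of |f|, for f a function on Omega_ Omega eps; by convention 0
   when K is not a subset of that set. *)
Definition sup_on Omega eps K (f : Rn -> R) : R :=
  if `[< K `<=` Omega_ Omega eps >] then sup [set `|f x| | x in K] else 0.

(* A function on U(Omega) = {(phi, x) | phi in A_ 0, x in Omega_ Omega phi} is
   represented by a total function F of (phi, x): none of the three sets below
   depends on the values of F outside U(Omega). *)
Definition Ee Omega : set ((Rn -> R) * Rn -> R) :=
  [set F | forall phi, A_ 0 phi ->
    smooth_on (Omega_ Omega phi) (fun x => F (phi, x))].

Definition EeM Omega : set ((Rn -> R) * Rn -> R) :=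
  [set F | Ee Omega F /\
    forall K, compact K -> K `<=` Omega ->
    forall a : multi_index n, exists N : nat, forall phi, A_ N phi ->
      (fun r : R =>
         sup_on Omega (dil r phi) K (mpartial a (fun x => F (dil r phi, x))))
      =O_at0 (fun r : R => r ^- N)].

Definition Ne Omega : set ((Rn -> R) * Rn -> R) :=
  [set F | Ee Omega F /\
    forall K, compact K -> K `<=` Omega ->
    forall (a : multi_index n) (m : nat),
    exists q : nat, forall phi, A_ q phi ->
      (fun r : R =>
         sup_on Omega (dil r phi) K (mpartial a (fun x => F (dil r phi, x))))
      =O_at0 (fun r : R => r ^+ m)].

(* Similarly, u eps stands for its restriction to Omega_ Omega eps, and only
   the eps in Ie matter. *)
Definition Pe Omega : set ((Rn -> R) -> Rn -> R) :=
  [set u | forall eps, Ie eps -> smooth_on (Omega_ Omega eps) (u eps)].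

Definition vee (u : (Rn -> R) -> Rn -> R) : (Rn -> R) * Rn -> R :=
  fun p => u p.1 p.2.

End full_algebra.

(* Main.v *)
Require Import Defs.
From mathcomp Require Import all_boot all_order all_algebra.
From mathcomp Require Import all_classical all_reals all_analysis.
From HB Require Import structures.
From mathcomp Require Import ring.

(** The conditions defining moderate and negligible elements bound, for each phi,
    the values of a net along the ray r |-> dil r phi, as r tends to 0. The
    big-O conditions over the index set bound the same net on principal
    down-sets, in terms of the diameter of the support. A principal down-set is
    the part r <= 1 of such a ray, and on the ray the diameter is a linear
    function of r: size_supp (dil r phi) = r * size_supp phi. Since size_supp phi
    is positive, a power of the diameter and the same power of r differ by a
    constant factor, and both kinds of estimates say the same thing for a given
    A_ q. This is [bigO_IeP], for any multiplicative gauge p in place of a power.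
    The theorem then only has to arrange quantifiers: a set A_ q for which the
    estimate holds is the index asked for in the definition of negligible
    elements, while in the definition of moderate elements the same N is both an
    index and an exponent, so one takes the larger of the two.

    What needs proof is the behaviour of dilations. They act on each A_ q
    ([A_dil]): smoothness is the chain rule for homotheties ([smooth_scale]), the
    support is a homothetic image ([supp_dil]), and the moments are multiplied by
    powers of r ([intRn_monomial_dil]), which is the change of variables
    x |-> r *: x in the n-dimensional Lebesgue integral. The latter follows from
    the scaling of the measure itself ([lebesgue_tuple_scales]), by induction on
    n, and from a change of variables for integrals along an invertible map that
    multiplies a measure by a constant ([Rintegral_scales]). Positivity of the
    diameter ([size_supp_gt0]) holds because a continuous function that is nonzero
    somewhere is nonzero at two points when n is at least 1. *)

Set Implicit Arguments.
Unset Strict Implicit.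
Unset Printing Implicit Defensive.

Import Order.TTheory GRing.Theory Num.Theory.
Import numFieldNormedType.Exports.

Local Open Scope classical_set_scope.
Local Open Scope ring_scope.

(** * Integration along a map that rescales a measure *)

Section scaling_integral.
Local Open Scope ereal_scope.
Context d (T : measurableType d) (R : realType).
Import HBNNSimple.

(** The factor sits on the side of the preimage: the homothety of ratio r on the
    line has factor r. *)
Definition scales (mu : set T -> \bar R) (S : T -> T) (c : R) : Prop :=
  measurable_fun setT S /\
  forall A, measurable A -> mu A = c%:E * mu (S @^-1` A).

Lemma nnsfun_comp_scale (S : T -> T) (h : {nnsfun T >-> R}) (k : R) :
  measurable_fun setT S -> (0 <= k)%R ->
  {h' : {nnsfun T >-> R} | forall x, h' x = (k * h (S x))%R}.
Proof.
move=> mS k0.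
have mg : measurable_fun setT (h \o S) by exact: measurableT_comp.
have fg : finite_set (range (h \o S)).
  by apply: (@sub_finite_set _ _ (range h)) => [_ [x _ <-]|]; [exists (S x)|].
have g0 x : (0 <= (h \o S) x)%R by exact: fun_ge0.
pose g : {nnsfun T >-> R} := HB.pack_for {nnsfun T >-> R} (h \o S)
  (isMeasurableFun.Build _ _ _ _ _ mg) (FiniteImage.Build _ _ _ fg)
  (isNonNegFun.Build _ _ _ g0).
by exists (scale_nnsfun g k0).
Qed.

(** The integral of a nonnegative function is the supremum of the integrals of
    the simple functions below it, and h |-> k * h o S sends those below f to
    some of those below k * f o S. Arguing on this supremum, rather than on
    limits of simple functions, keeps the product sigma-algebra of tuples apart
    from the topology of row vectors. *)
Lemma le_integral_scales (mu : {measure set T -> \bar R}) (S : T -> T)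
    (c k : R) (f : T -> \bar R) :
  scales mu S c -> (0 < c)%R -> (0 < k)%R -> (forall x, 0 <= f x) ->
  k%:E * \int[mu]_x f x <= c%:E * \int[mu]_x (k%:E * f (S x)).
Proof.
move=> [mS muS] c0 k0 f0.
rewrite [X in _ * X <= _]ge0_integralTE//.
rewrite -ereal_sup_pZl//; apply: ge_ereal_sup => _ [_ [h /= hf <-] <-].
have [g gE] := nnsfun_comp_scale h mS (ltW k0).
have [h' h'E] := nnsfun_comp_scale h mS (@ler01 R).
have {}h'E x : h' x = h (S x) by rewrite h'E mul1r.
(* S maps the fibre of h' over r into that of h, with measures in ratio c. *)
have hE : sintegral mu h = c%:E * sintegral mu h'.
  rewrite !sintegralET ge0_mule_fsumr; last exact: nnsfun_mulemu_ge0.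
  apply: eq_fsbigr => r _; rewrite muleCA muS//; congr (_ * (_ * mu _)).
  by apply/seteqP; split=> x /=; rewrite h'E.
have -> : k%:E * sintegral mu h = c%:E * sintegral mu g.
  rewrite hE muleCA -sintegralrM; congr (_ * _); apply: eq_sintegral => x.
  by rewrite /= h'E gE.
rewrite lee_pmul2l//.
rewrite [leRHS]ge0_integralTE; last by move=> x; rewrite mule_ge0// lee_fin ltW.
apply: ereal_sup_ubound; exists g => //= x.
by rewrite gE EFinM lee_pmul2l// lte_fin.
Qed.

(** The missing inequality is the previous lemma for the inverse map S', the
    constants c^-1 and k^-1, and the function k * f o S. *)
Lemma ge0_integral_scales (mu : {measure set T -> \bar R}) (S S' : T -> T)
    (c k : R) (f : T -> \bar R) :
  scales mu S c -> scales mu S' c^-1 -> cancel S' S ->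
  (0 < c)%R -> (0 < k)%R -> (forall x, 0 <= f x) ->
  c%:E * \int[mu]_x (k%:E * f (S x)) = k%:E * \int[mu]_x f x.
Proof.
move=> muS muS' S'K c0 k0 f0; apply/eqP; rewrite eq_le le_integral_scales// andbT.
have ci0 : (0 < c^-1)%R by rewrite invr_gt0.
have ki0 : (0 < k^-1)%R by rewrite invr_gt0.
have kf0 x : 0 <= k%:E * f (S x) by rewrite mule_ge0// lee_fin ltW.
have := le_integral_scales muS' ci0 ki0 kf0.
under [X in _ <= _ * X]eq_integral do
  rewrite S'K muleA -EFinM mulVf ?gt_eqF// mul1e.
rewrite -(@lee_pmul2l _ c%:E)// -(@lee_pmul2l _ k%:E)//.
rewrite !muleA -!EFinM mulfK ?gt_eqF// mulrAC mulfV ?gt_eqF// mul1r; exact.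
Qed.

Lemma integral_scales (mu : {measure set T -> \bar R}) (S S' : T -> T)
    (c k : R) (f : T -> \bar R) :
  scales mu S c -> scales mu S' c^-1 -> cancel S' S ->
  (0 < c)%R -> (0 < k)%R ->
  \int[mu]_x (k%:E * f (S x)) = (c^-1 * k)%:E * \int[mu]_x f x.
Proof.
move=> muS muS' S'K c0 k0.
have ge0E g : (forall x, 0 <= g x) ->
    \int[mu]_x (k%:E * g (S x)) = (c^-1 * k)%:E * \int[mu]_x g x.
  move=> g0; rewrite EFinM -muleA -(ge0_integral_scales muS muS' S'K)// muleA.
  by rewrite -EFinM mulVf ?gt_eqF// mul1e.
rewrite integralE [in RHS]integralE.
under eq_integral do rewrite (ge0_funeposM _ (ltW k0)) (funepos_comp f S) /=.
under [X in _ - X]eq_integral do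
  rewrite (ge0_funenegM _ (ltW k0)) (funeneg_comp f S) /=.
rewrite !ge0E//.
have ck0 : (0 < c^-1 * k)%R by rewrite mulr_gt0// invr_gt0.
move: (_ * k)%R ck0 => a a0.
(* If the negative part has infinite integral, both sides are -oo. *)
have : 0 <= \int[mu]_x f^\- x by apply: integral_ge0.
move: (\int[mu]_x f^\- x) (\int[mu]_x f^\+ x) => [y| |] x // _.
  by rewrite muleBr// fin_num_adde_defl.
by rewrite gt0_muley ?lte_fin// !addeNy gt0_muleNy ?lte_fin.
Qed.

Lemma Rintegral_scales (mu : {measure set T -> \bar R}) (S S' : T -> T)
    (c k : R) (f : T -> R) :
  scales mu S c -> scales mu S' c^-1 -> cancel S' S ->
  (0 < c)%R -> (0 < k)%R ->
  Rintegral mu setT (fun x => k * f (S x))%R =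
  (c^-1 * k * Rintegral mu setT f)%R.
Proof.
move=> muS muS' S'K c0 k0; rewrite /Rintegral.
under eq_integral do rewrite EFinM.
rewrite (integral_scales (EFin \o f) muS muS' S'K c0 k0).
have : (0 < c^-1 * k)%R by rewrite mulr_gt0// invr_gt0.
move: (_ * k)%R => a a0.
(* An infinite integral has real value 0, and stays infinite once scaled. *)
by case: (\int[mu]_x _) => [x| |] //=;
  rewrite ?(gt0_muley, gt0_muleNy) ?lte_fin//= mulr0.
Qed.

End scaling_integral.

(** * Homotheties and the n-dimensional Lebesgue measure *)

Section scaling_lebesgue.
Context (R : realType).
Local Notation leb1 := (@lebesgue_measure R).

(** Uniqueness theorems for measures compare measures: this makes one of the set
    function A |-> c * mu (S @^-1` A). *)
Lemma pushforward_scaled d (T : measurableType d) (mu : {measure set T -> \bar R})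
    (S : T -> T) (c : R) : measurable_fun setT S -> 0 <= c ->
  exists m : {measure set T -> \bar R}, forall A, m A = (c%:E * mu (S @^-1` A))%E.
Proof.
by move=> mS c0; unshelve eexists (mscale (NngNum c0) (pushforward mu S)).
Qed.

Lemma lebesgue_measure_scales (r : R) : 0 < r ->
  scales leb1 (fun x : measurableTypeR R => r * x) r.
Proof.
move=> r0.
have mr : measurable_fun setT
    (fun x : measurableTypeR R => r * x : measurableTypeR R).
  exact: measurable_realfun.mulrl_measurable.
split=> // A mA.
have [m mE] := pushforward_scaled leb1 mr (ltW r0).
rewrite (@lebesgue_measure_unique R m)//.
move=> _ [[a b] _ <-] /=.
rewrite mE.
have -> : (fun x : R => r * x) @^-1` `]a, b]%classic =
    `]r^-1 * a, r^-1 * b]%classic.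
  apply/seteqP; split=> x /=; rewrite !in_itv /= ![r^-1 * _]mulrC;
  by rewrite ltr_pdivrMr// ler_pdivlMr// [x * r]mulrC.
rewrite lebesgue_measure_itv [X in (_ * X)%E]lebesgue_measure_itv /= !lte_fin.
rewrite ltr_pM2l ?invr_gt0//.
case: ifP => _; last by rewrite mule0.
by rewrite -!EFinB -mulrBr -EFinM mulrA mulfV ?gt_eqF// mul1r.
Qed.

Definition tuple_scale n (r : R) (t : n.-tuple (measurableTypeR R)) :
  n.-tuple (measurableTypeR R) := [tuple r * tnth t i | i < n].

Lemma measurable_tuple_scale n (r : R) :
  measurable_fun setT (@tuple_scale n r).
Proof.
apply/measurable_fun_tnthP => i.
rewrite (_ : _ \o _ = (fun x : measurableTypeR R => r * x : measurableTypeR R)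
  \o (fun t => tnth t i)).
  apply: measurableT_comp; last exact: measurable_tnth.
  exact: measurable_realfun.mulrl_measurable.
by apply/funext => t; rewrite /= tnth_mktuple.
Qed.

(** By induction on the dimension. The measure in dimension n.+1 is a product,
    hence determined by its values on boxes X `*` Y, where the homothety acts on
    each side separately: the line contributes r and the tail r ^+ n. *)
Lemma lebesgue_tuple_scales n (r : R) : 0 < r ->
  scales (lebesgue_tuple R n) (@tuple_scale n r) (r ^+ n).
Proof.
move=> r0; split; first exact: measurable_tuple_scale.
elim: n => [|n IH] A mA.
  rewrite expr0 mul1e; congr (lebesgue_tuple R 0 _).
  by apply/seteqP; split=> x; rewrite /= (tuple0 x) (tuple0 (tuple_scale _ _)).
have mleb := lebesgue_measure_scales r0.
rewrite /=.
pose S (p : measurableTypeR R * n.-tuple (measurableTypeR R)) :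
  (measurableTypeR R * n.-tuple (measurableTypeR R))%type :=
  (r * p.1, tuple_scale r p.2).
have mS : measurable_fun setT S.
  apply/measurable_fun_pairP; split.
    exact: (measurableT_comp mleb.1 measurable_fst).
  exact: (measurableT_comp (@measurable_tuple_scale n r) measurable_snd).
have r1 : 0 <= r ^+ n.+1 by rewrite exprn_ge0// ltW.
have [m mE] := pushforward_scaled (leb1 \x lebesgue_tuple R n)%E mS r1.
rewrite /lebesgue_cons /pushforward.
have mC : measurable (@tuple_cons R n @^-1` A).
  by rewrite -[X in measurable X]setTI; exact: measurable_tuple_cons.
rewrite (@product_measure_unique _ _ _ _ _ leb1 (lebesgue_tuple R n) m _ _ mC).
  rewrite mE /=; congr (_ * product_measure1 _ _ _)%E.
  congr (_ @^-1` A); apply/funext => -[x t]; apply: eq_from_tnth => i.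
  by case: (unliftP ord0 i) => [j|] ->;
    rewrite /= !tnth_mktuple ?tnthS ?tnth0// !tnth_mktuple.
move=> X Y mX mY; rewrite mE (IH _ mY).
rewrite [X in (_ = X * _)%E](mleb.2 _ mX).
transitivity ((r ^+ n.+1)%:E * (leb1 (( *%R r) @^-1` X) *
   lebesgue_tuple R n (tuple_scale r @^-1` Y)))%E.
  rewrite -product_measure1E//.
  - by rewrite -[X in measurable X]setTI; exact: mleb.1.
  - by rewrite -[X in measurable X]setTI; exact: measurable_tuple_scale.
by rewrite exprS EFinM muleACA.
Qed.

Lemma intRn_scale n (r k : R) (f : 'rV[R]_n -> R) : 0 < r -> 0 < k ->
  intRn (fun x => k * f (r *: x)) = r ^- n * k * intRn f.
Proof.
move=> r0 k0.
have ri0 : 0 < r^-1 by rewrite invr_gt0.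
have scaleVK : cancel (@tuple_scale n r^-1) (@tuple_scale n r).
  move=> t; apply: eq_from_tnth => i.
  by rewrite !tnth_mktuple mulrA mulfV ?gt_eqF// mul1r.
have := lebesgue_tuple_scales n ri0; rewrite exprVn => muV.
rewrite /intRn -(Rintegral_scales
  (fun t : n.-tuple (measurableTypeR R) => f (\row_i tnth t i))
  (lebesgue_tuple_scales n r0) muV scaleVK) ?exprn_gt0//.
congr (Rintegral _ _ _); apply/funext => t; congr (_ * f _).
by apply/rowP => i; rewrite !mxE tnth_mktuple.
Qed.

Lemma monomial_scale n (r : R) (a : multi_index n) (x : 'rV[R]_n) :
  monomial a (r *: x) = r ^+ morder a * monomial a x.
Proof.
rewrite /monomial /morder -prodrXr -big_split /=; apply: eq_bigr => i _.
by rewrite mxE exprMn.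
Qed.

(** Dilation multiplies each moment by a power of r. So it preserves the total
    integral, and moments that vanish keep vanishing. *)
Lemma intRn_monomial_dil n (r : R) (a : multi_index n) (f : 'rV[R]_n -> R) :
  0 < r ->
  intRn (fun x => monomial a x * dil r f x) =
  r ^+ morder a * intRn (fun x => monomial a x * f x).
Proof.
move=> r0; have ri0 : 0 < r^-1 by rewrite invr_gt0.
pose g x := monomial a x * f x.
rewrite (_ : (fun x => _) = fun x => r ^- n * r ^+ morder a * g (r^-1 *: x)).
  rewrite intRn_scale// ?mulr_gt0 ?invr_gt0 ?exprn_gt0//.
  by rewrite exprVn invrK mulrA mulfV ?mul1r// gt_eqF ?exprn_gt0.
apply/funext => x; rewrite /g /dil monomial_scale exprVn.
rewrite mulrCA -!mulrA; congr (_ * _).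
by rewrite mulVKf ?gt_eqF ?exprn_gt0.
Qed.

End scaling_lebesgue.

(** * Derivatives, supports and diameters under homotheties *)

Section scaling_calculus.
Context (R : realType) (n : nat).
Local Notation Rn := 'rV[R]_n.
Implicit Types (c k r : R) (f g : Rn -> R).

(** The substitution h |-> k * h turns one difference quotient along v into the
    other. Derivability along v is all that [smooth_on] provides at this stage. *)
Lemma is_derive_scale c k g (x v : Rn) : k != 0 -> derivable g (k *: x) v ->
  is_derive x v (fun y => c * g (k *: y)) (c * k * 'D_v g (k *: x)).
Proof.
move=> k0 dg.
pose q h : R := h^-1 *: ((g \o shift (k *: x)) (h *: v) - g (k *: x)).
have kh : k * h @[h --> (0 : R)^'] --> (0 : R)^'.
  have kc : k * h @[h --> (0 : R)] --> (0 : R).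
    by rewrite -[X in _ --> X](mulr0 k); apply: cvgMl_tmp; exact: cvg_id.
  move=> A A0.
  have : \forall h \near (0 : R), k * h != 0 -> A (k * h) := kc _ A0.
  by apply: filterS => h kA h0; apply: kA; exact: mulf_neq0.
have qkh : c * k * q (k * h) @[h --> (0 : R)^'] --> c * k * 'D_v g (k *: x).
  have dg' : q h @[h --> (0 : R)^'] --> 'D_v g (k *: x) := dg.
  exact: (cvgMl_tmp (a := c * k) (g := fun h => q (k * h)) (cvg_comp _ _ kh dg')).
have E : (fun h : R => h^-1 *: (((fun y => c * g (k *: y)) \o shift x) (h *: v) -
      (c * g (k *: x)) : R)) = (fun h => c * k * q (k * h)).
  apply/funext => h; rewrite /q invfM.
  change (h^-1 * (c * g (k *: (h *: v + x)) - c * g (k *: x)) =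
    c * k * (k^-1 / h * (g ((k * h) *: v + k *: x) - g (k *: x)))).
  rewrite scalerDr scalerA.
  by move: h^-1 (g _) (g _) => hi a b; field.
split; rewrite /derivable /derive.
  by rewrite E; apply/cvg_ex; eexists; exact: qkh.
by rewrite E; exact: cvg_lim qkh.
Qed.

Lemma partials_scale (f : Rn -> R) c k (s : seq 'I_n) : smooth_on setT f ->
  k != 0 ->
  partials s (fun x => c * f (k *: x)) =
  fun x => c * k ^+ size s * partials s f (k *: x).
Proof.
move=> fs k0; elim: s => [|i s IH] /=; first by rewrite expr0 mulr1.
rewrite IH /partial; apply/funext => x.
have [_ /(_ i) df] := fs s (k *: x) I.
by rewrite (@derive_val _ _ _ _ _ _ _ (is_derive_scale _ k0 df)) exprSr mulrA.
Qed.

Lemma smooth_scale (f : Rn -> R) c k : smooth_on setT f ->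
  k != 0 -> smooth_on setT (fun x => c * f (k *: x)).
Proof.
move=> fs k0 s x _; rewrite partials_scale//.
have [cf df] := fs s (k *: x) I; split; last first.
  by move=> i; case: (is_derive_scale (c * k ^+ size s) k0 (df i)).
have cg : {for x, continuous (fun y : Rn => partials s f (k *: y))}.
  have ck : (k *: y : Rn) @[y --> x] --> k *: x by exact: scaler_continuous.
  exact: (cvg_comp _ _ ck cf).
exact: (cvgMl_tmp (a := c * k ^+ size s) cg).
Qed.

(** One inclusion is continuity of the homothety, the other one is continuity of
    its inverse. *)
Lemma closure_preimage_scale k (A : set Rn) : k != 0 ->
  closure ( *:%R k @^-1` A) = *:%R k @^-1` closure A.
Proof.
have sub (l : R) (B : set Rn) :
    closure ( *:%R l @^-1` B) `<=` *:%R l @^-1` closure B.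
  have /continuous_closedP cl : continuous ( *:%R l : Rn -> Rn).
    exact: scaler_continuous.
  move=> x; move/closure_id : (cl _ (@closed_closure _ B)) => ->.
  by apply: closure_subset => y /=; exact: subset_closure.
move=> k0; apply/seteqP; split; first exact: sub.
move=> x /= kx.
have := sub k^-1 ( *:%R k @^-1` A) (k *: x).
rewrite /preimage /= scalerA mulVf// scale1r; apply.
by move: kx; congr closure; apply/seteqP; split => y /=;
  rewrite scalerA mulfV// scale1r.
Qed.

Lemma supp_dil r f : 0 < r -> supp (dil r f) = [set r *: x | x in supp f].
Proof.
move=> r0; have rn0 : r != 0 by rewrite gt_eqF.
rewrite /supp; transitivity ( *:%R r^-1 @^-1` closure [set x | f x != 0]).
  rewrite -closure_preimage_scale ?invr_eq0//; congr closure.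
  apply/seteqP; split=> x /=;
    by rewrite /dil mulf_eq0 invr_eq0 expf_eq0 (negbTE rn0) andbF.
apply/seteqP; split=> x /=.
  by move=> fx; exists (r^-1 *: x) => //; rewrite scalerA mulfV// scale1r.
by move=> [y fy <-]; rewrite scalerA mulVf// scale1r.
Qed.

Lemma test_function_dil r f : 0 < r -> test_function f -> test_function (dil r f).
Proof.
move=> r0 [sf cf]; split.
  by apply: smooth_scale => //; rewrite invr_eq0 gt_eqF.
rewrite supp_dil//; apply: continuous_compact => //.
by apply: continuous_subspaceT => x; exact: scaler_continuous.
Qed.

Lemma enorm_scale r (x : Rn) : 0 <= r -> enorm (r *: x) = r * enorm x.
Proof.
move=> r0; rewrite /enorm; under eq_bigr do rewrite mxE exprMn.
by rewrite -mulr_sumr sqrtrM ?sqr_ge0// sqrtr_sqr ger0_norm.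
Qed.

Lemma enorm_gt0 (x : Rn) : x != 0 -> 0 < enorm x.
Proof.
move=> /rV0Pn[i xi]; rewrite sqrtr_gt0 (bigD1 i)//= ltr_pwDl//.
  by rewrite exprn_even_gt0.
by apply: sumr_ge0 => j _; exact: sqr_ge0.
Qed.

Lemma enorm_le_norm (x : Rn) : enorm x <= Num.sqrt (`|x| ^+ 2 *+ n).
Proof.
rewrite ler_sqrt ?mulrn_wge0 ?sqr_ge0// -[X in _ *+ X]card_ord -sumr_const.
apply: ler_sum => i _; rewrite -(real_normK (num_real (x 0 i))) lerXn2r ?nnegrE//.
rewrite [X in _ <= X]mx_normrE.
exact: (le_bigmax _ (fun ij => `|x ij.1 ij.2|) (0, i)).
Qed.

Lemma sup_scale r (E : set R) : 0 < r -> has_sup E ->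
  sup [set r * x | x in E] = r * sup E.
Proof.
move=> r0 [[x0 Ex0] ubE]; apply/eqP; rewrite eq_le; apply/andP; split.
  apply: ge_sup; first by exists (r * x0); exists x0.
  by move=> _ [x Ex <-]; rewrite ler_pM2l// ub_le_sup.
rewrite mulrC -ler_pdivlMr//; apply: ge_sup; first by exists x0.
move=> x Ex; rewrite ler_pdivlMr// mulrC; apply: ub_le_sup; last by exists x.
by exists (r * sup E) => _ [y Ey <-]; rewrite ler_pM2l// ub_le_sup.
Qed.

(** This makes the supremum that defines the diameter a true one: by convention
    the supremum of an unbounded set is 0. *)
Lemma compact_distances_ub (A : set Rn) : compact A ->
  has_ubound [set enorm (p.1 - p.2) | p in A `*` A].
Proof.
move=> /compact_bounded[M [_ MA]].
have {}MA : forall x, A x -> `|x| <= M + 1 by apply: MA; rewrite ltrDl.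
(* M + 1 bounds the sup norm on A, so 2 (M + 1) bounds that of differences. *)
exists (Num.sqrt ((M + 1 + (M + 1)) ^+ 2 *+ n)) => _ [[x y] [/= Ax Ay] <-].
have xyM : `|x - y| <= M + 1 + (M + 1).
  by rewrite (le_trans (ler_normB _ _))// lerD ?MA.
apply: le_trans (enorm_le_norm _) _; rewrite ler_wsqrtr// lerMn2r.
by rewrite lerXn2r ?orbT ?nnegrE ?(le_trans _ xyM).
Qed.

Lemma diam_scale r (A : set Rn) : 0 < r -> compact A -> A !=set0 ->
  diam [set r *: x | x in A] = r * diam A.
Proof.
move=> r0 cA [a Aa]; rewrite /diam -sup_scale//; last first.
  split; last exact: compact_distances_ub.
  by exists (enorm (a - a)); exists (a, a).
have rE (x y : Rn) : enorm (r *: x - r *: y) = r * enorm (x - y).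
  by rewrite -scalerBr enorm_scale// ltW.
congr sup; apply/seteqP; split.
  move=> _ [[_ _] [/= [x Ax <-] [y Ay <-]] <-]; rewrite rE.
  by exists (enorm (x - y)) => //; exists (x, y).
move=> _ [_ [[x y] [/= Ax Ay] <-] <-]; rewrite -rE.
by exists (r *: x, r *: y) => //=; split; [exists x|exists y].
Qed.

Lemma diam_gt0 (A : set Rn) x y : compact A -> A x -> A y -> x != y ->
  0 < diam A.
Proof.
move=> cA Ax Ay xy; apply: (@lt_le_trans _ _ (enorm (x - y))).
  by rewrite enorm_gt0// subr_eq0.
by apply: ub_le_sup; [exact: compact_distances_ub|exists (x, y)].
Qed.

End scaling_calculus.

(** * Dilations in the index set and big-O estimates *)

Section index_facts.
Context (R : realType) (n : nat).
Local Notation Rn := 'rV[R]_n.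
Local Notation at0 := (0^'+).
Implicit Types (r s : R) (f phi eps : Rn -> R).

Lemma intRn_dil r f : 0 < r -> intRn (dil r f) = intRn f.
Proof.
move=> r0; pose a0 : multi_index n := [ffun=> 0%N].
have m0 x : monomial a0 x = 1 :> R.
  by rewrite /monomial big1// => i _; rewrite ffunE expr0.
have a00 : morder a0 = 0%N by rewrite /morder big1// => i _; rewrite ffunE.
have := intRn_monomial_dil a0 f r0; rewrite a00 expr0 mul1r.
by under eq_fun do rewrite m0 mul1r; under [in RHS]eq_fun do rewrite m0 mul1r.
Qed.

Lemma A_dil q r phi : 0 < r -> A_ q phi -> A_ q (dil r phi).
Proof.
move=> r0 [tphi iphi mphi]; split; first exact: test_function_dil.
  by rewrite intRn_dil.
by move=> a aq; rewrite intRn_monomial_dil// mphi// mulr0.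
Qed.

Lemma A_nonincreasing p q : (p <= q)%N -> A_ q `<=` @A_ R n p.
Proof.
move=> pq phi [tphi iphi mphi]; split=> // a /andP[a1 ap].
by apply: mphi; rewrite a1 (leq_trans ap).
Qed.

Lemma dil_comp s r f : dil s (dil r f) = dil (s * r) f.
Proof.
apply/funext => x; rewrite /dil mulrA -invfM -exprMn scalerA.
by rewrite -invfM [r * s]mulrC.
Qed.

(** A function with integral 1 is nonzero at some x and, by continuity, also at
    h *: v + x for small h != 0. Such a point differs from x since n is at least
    1; in dimension 0 all diameters are 0. *)
Lemma supp_nontrivial q phi : (1 <= n)%N -> A_ q phi ->
  exists x y, [/\ supp phi x, supp phi y & x != y].
Proof.
move=> n1 [[sphi cphi] iphi _].
have [x fx] : exists x, phi x != 0.
  apply: contrapT => /forallNP phi0; have : intRn phi = 0.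
    rewrite /intRn /Rintegral.
    rewrite (_ : (fun _ => _) = cst 0%E) ?integral0//.
    apply/funext => t /=; congr (_%:E).
    by have /negP := phi0 (\row_i tnth t i); rewrite negbK => /eqP.
  by rewrite iphi => /eqP; rewrite oner_eq0.
pose v : Rn := const_mx 1.
have cx : (h *: v + x) @[h --> (0 : R)] --> (0 *: v + x).
  by apply: cvgD; [apply: cvgZr_tmp; exact: cvg_id|exact: cvg_cst].
rewrite scale0r add0r in cx.
have [cphix _] := sphi [::] x I.
have nz : \forall y \near phi x, y != 0.
  exact: (open_nbhs_nbhs (conj (@open_neq _ 0) fx)).
have near_h : \forall h \near (0 : R), phi (h *: v + x) != 0.
  exact: (cvg_comp _ _ cx cphix _ nz).
have [h [h0 fh]] : exists h : R, h != 0 /\ phi (h *: v + x) != 0.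
  apply: (@filter_ex _ (0 : R)^').
  near=> h; split; first by near: h; exact: nbhs_dnbhs_neq.
  by near: h; exact: nbhs_dnbhs near_h.
exists x, (h *: v + x); split; try exact: subset_closure.
rewrite eq_sym -subr_eq0 addrK scaler_eq0 (negbTE h0)/=.
by apply/rV0Pn; exists (Ordinal n1); rewrite mxE oner_neq0.
Unshelve. all: by end_near. Qed.

Lemma size_supp_gt0 q phi : (1 <= n)%N -> A_ q phi -> 0 < size_supp phi.
Proof.
move=> n1 Aphi; have [x [y [px py xy]]] := supp_nontrivial n1 Aphi.
by have [[_ cphi] _ _] := Aphi; exact: diam_gt0 cphi px py xy.
Qed.

Lemma size_supp_dil q r phi : (1 <= n)%N -> 0 < r -> A_ q phi ->
  size_supp (dil r phi) = r * size_supp phi.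
Proof.
move=> n1 r0 Aphi; have [x [_ [px _ _]]] := supp_nontrivial n1 Aphi.
rewrite /size_supp supp_dil// diam_scale//; last by exists x.
by have [[]] := Aphi.
Qed.

(** The elements below dil r0 phi are exactly the dilations of phi by ratios at
    most r0, and the size of dil r phi is r times that of phi. So a bound in
    terms of p (size_supp eps) on a principal down-set is a bound in terms of
    p r near 0, up to the constant factor p (size_supp phi), which is positive. *)
Lemma bigO_IeP (x : (Rn -> R) -> R) (p : R -> R) : (1 <= n)%N ->
  (forall s t, 0 < s -> 0 < t -> p (s * t) = p s * p t) ->
  (forall s, 0 < s -> 0 < p s) ->
  bigO_Ie x (fun eps => p (size_supp eps)) <->
  exists q, forall phi, A_ q phi ->
    (fun r : R => x (dil r phi)) =O_at0 p.
Proof.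
move=> n1 pM p0; split.
  move=> [_ [q _ <-] xO]; exists q => phi Aphi.
  have [H [eps0 [H0 [[_ [r0 /andP[r00 r01] ->]] _] xH]]] := xO _ Aphi.
  have sp := size_supp_gt0 n1 Aphi.
  apply/eqO_exP; exists (H * p (size_supp phi)); rewrite ?mulr_gt0 ?p0//.
  near=> r.
  have r_gt0 : 0 < r by [].
  have r_le : r <= r0 by near: r; exact: nbhs_right_le.
  have Ar : A_ q (dil r phi) by exact: A_dil.
  have -> : H * p (size_supp phi) * `|p r| = H * `|p (size_supp (dil r phi))|.
    rewrite (size_supp_dil n1 r_gt0 Aphi) pM// normrM.
    by rewrite [X in _ * (_ * X)]ger0_norm ?(ltW (p0 _ sp))//; ring.
  apply: xH; split=> //; split; first exact: A_nonincreasing Ar.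
  exists (r / r0); first by rewrite divr_gt0// ler_pdivrMr// mul1r.
  by rewrite dil_comp divfK// gt_eqF.
move=> [q xO]; exists (A_ q); first by exists q.
move=> phi Aphi.
have /eqO_exP[H H0 xH] := xO _ Aphi.
have sp := size_supp_gt0 n1 Aphi.
have [d /= d0 {}xH] : \forall r \near at_right (0 : R),
    `|x (dil r phi)| <= H * `|p r| := xH.
have {}xH r : 0 < r < d -> `|x (dil r phi)| <= H * `|p r|.
  by move=> /andP[r_gt0 rd]; apply: xH => //=; rewrite sub0r normrN gtr0_norm.
(* The estimate holds on the open interval ]0, d[; indices below phi are its
   dilations by ratios at most 1. *)
pose r0 := Num.min 1 (d / 2).
have r0_gt0 : 0 < r0 by rewrite lt_min ltr01 divr_gt0.
have r0_le1 : r0 <= 1 by rewrite ge_min lexx.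
have r0d : r0 < d by rewrite gt_min ltr_pdivrMr// ltr_pMr// ltr1n orbT.
exists (H / p (size_supp phi)), (dil r0 phi); split.
- by rewrite divr_gt0// p0.
- split; last exact: A_dil.
  split; last by exists r0 => //; rewrite r0_gt0.
  by apply: A_nonincreasing (A_dil r0_gt0 Aphi).
- move=> _ [[_ [s /andP[s0 s1] ->]] _]; rewrite dil_comp.
  have sr0 : 0 < s * r0 by rewrite mulr_gt0.
  rewrite (size_supp_dil n1 sr0 Aphi) pM// normrM.
  rewrite (ger0_norm (ltW (p0 _ sp))) mulrACA mulVf ?gt_eqF ?p0// mulr1.
  by apply: xH; rewrite sr0 (le_lt_trans _ r0d)// ler_piMl// ltW.
Unshelve. all: by end_near. Qed.

Lemma bigO_Ie_pow (x : (Rn -> R) -> R) (m : nat) : (1 <= n)%N ->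
  bigO_Ie x (fun eps => size_supp eps ^+ m) <->
  exists q, forall phi, A_ q phi ->
    (fun r : R => x (dil r phi)) =O_at0 (fun r => r ^+ m).
Proof.
move=> n1; apply: (@bigO_IeP x (fun r => r ^+ m) n1) => s *.
  exact: exprMn.
exact: exprn_gt0.
Qed.

Lemma bigO_Ie_powV (x : (Rn -> R) -> R) (N : nat) : (1 <= n)%N ->
  bigO_Ie x (fun eps => size_supp eps ^- N) <->
  exists q, forall phi, A_ q phi ->
    (fun r : R => x (dil r phi)) =O_at0 (fun r => r ^- N).
Proof.
move=> n1; apply: (@bigO_IeP x (fun r => r ^- N) n1) => s *.
  by rewrite exprMn invfM.
by rewrite invr_gt0 exprn_gt0.
Qed.

End index_facts.

Unset Implicit Arguments.

Theorem theorem25 (R : realType) (n : nat) (n_ge1 : (1 <= n)%N)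
    (Omega : set 'rV[R]_n) (openOmega : open Omega)
    (u : ('rV[R]_n -> R) -> 'rV[R]_n -> R) (uP : Pe Omega u) :
  (EeM Omega (vee u) <->
    (forall K : set 'rV[R]_n, compact K -> K `<=` Omega ->
     forall a : multi_index n, exists N : nat,
       bigO_Ie (fun eps => sup_on Omega eps K (mpartial a (u eps)))
               (fun eps => size_supp eps ^- N)))
  /\
  (Ne Omega (vee u) <->
    (forall K : set 'rV[R]_n, compact K -> K `<=` Omega ->
     forall (a : multi_index n) (m : nat),
       bigO_Ie (fun eps => sup_on Omega eps K (mpartial a (u eps)))
               (fun eps => size_supp eps ^+ m))).
Proof.
split; split.
- move=> [_ uM] K cK KO a; have [N uN] := uM K cK KO a.
  by exists N; apply/(bigO_Ie_powV _ _ n_ge1); exists N.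
- move=> uM; split=> // K cK KO a.
  have [N /(bigO_Ie_powV _ _ n_ge1)[q uN]] := uM K cK KO a.
  (* The estimate holds on A_ q with exponent N; one integer must serve as both
     the exponent and the index. *)
  exists (maxn N q) => phi Aphi.
  have /eqO_exP[H H0 uH] := uN _ (A_nonincreasing (leq_maxr N q) Aphi).
  apply/eqO_exP; exists H => //; near=> r.
  have r0 : 0 < r by [].
  have r1 : r <= 1 by near: r; exact: nbhs_right_le.
  apply: (@le_trans _ _ (H * `|r ^- N|)); first by near: r.
  rewrite ler_pM2l// !gtr0_norm ?invr_gt0 ?exprn_gt0// lef_pV2 ?posrE ?exprn_gt0//.
  by rewrite ler_wiXn2l ?leq_maxl// ltW.
- move=> [_ uN] K cK KO a m; apply/(bigO_Ie_pow _ _ n_ge1); exact: uN.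
- move=> uN; split=> // K cK KO a m.
  by have /(bigO_Ie_pow _ _ n_ge1) := uN K cK KO a m.
Unshelve. all: by end_near. Qed.
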